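(* Let $f\in\dot{BV}(\mathbb R)$ and let $u$ solve the initial value problem $\frac{\partial u}{\partial t}=\frac{\partial^2u}{\partial x^2}$, $u(x,0)=f(x)$. Then $\frac{\partial u}{\partial t}\in L^{\frac32,\infty}(\mathbb R^2_+)$ and $\frac{\partial u}{\partial x}\in L^{3,\infty}(\mathbb R^2_+)$.
   Context: $\dot{BV}(\mathbb R)$ is the space of (locally integrable) functions on $\mathbb R$, modulo constants, whose distributional derivative is a finite measure. The solution $u$ is the one given by the heat semigroup, $u(x,t)=e^{t\Delta}f(x)$ for $t>0$ (convolution of $f$ with the heat kernel). $\mathbb R^2_+=\{(x,t):x\in\mathbb R,t>0\}$ with Lebesgue measure $dx\,dt$, and $L^{p,\infty}$ is weak $L^p$, i.e. the space of measurable $g$ with $\sup_{\lambda>0}\lambda\,\mathrm{meas}(\{|g|>\lambda\})^{1/p}<\infty$. *)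

(* Defs.v *)
From HB Require Import structures.
From mathcomp Require Import all_boot all_order all_algebra.
From mathcomp Require Import all_classical all_reals all_analysis.

Set Implicit Arguments.
Unset Strict Implicit.
Unset Printing Implicit Defensive.

Import Order.TTheory GRing.Theory Num.Theory.
Import numFieldNormedType.Exports.

Local Open Scope classical_set_scope.
Local Open Scope ring_scope.

Definition test_function (R : realType) (phi : R -> R) : Prop :=
  (forall (n : nat) (x : R), derivable (derive1n n phi) x 1) /\
  compact (closure [set x | phi x != 0]).

(* Integral against a signed measure, through its Jordan decomposition; it does
   not depend on which Hahn decomposition is used. *)
Definition charge_integral d (T : measurableType d) (R : realType)
    (nu : {charge set T -> \bar R}) (P N : set T)
    (nuPN : hahn_decomposition nu P N) (g : T -> R) : R :=
  \int[jordan_pos nuPN]_x g x - \int[jordan_neg nuPN]_x g x.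

(* A charge in the library is finite-valued, hence a finite signed measure. *)
Definition distributional_derivative (R : realType) (f : R -> R)
    (nu : {charge set (measurableTypeR R) -> \bar R}) : Prop :=
  forall (P N : set (measurableTypeR R)) (nuPN : hahn_decomposition nu P N)
    (phi : R -> R), test_function phi ->
    \int[lebesgue_measure]_x (f x * derive1 phi x) = - charge_integral nuPN phi.

(* Functions representing a class of the homogeneous space, whose elements are
   functions modulo constants. *)
Definition homogeneous_BV (R : realType) (f : R -> R) : Prop :=
  locally_integrable setT f /\
  exists nu : {charge set (measurableTypeR R) -> \bar R},
    distributional_derivative f nu.

Definition heat_kernel (R : realType) (t x : R) : R :=
  (Num.sqrt (4 * pi * t))^-1 * expR (- (x ^+ 2) / (4 * t)).

Definition heat_semigroup (R : realType) (t : R) (f : R -> R) (x : R) : R :=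
  \int[lebesgue_measure]_y (heat_kernel t (x - y) * f y).

Definition weakLp d (T : measurableType d) (R : realType)
    (mu : {measure set T -> \bar R}) (D : set T) (p : R) (g : T -> R) : Prop :=
  measurable_fun D g /\
  (ereal_sup [set (l%:E * mu (D `&` [set z | (l < `|g z|)%R]) `^ p^-1)%E
             | l in [set l : R | (0 < l)%R]] < +oo)%E.

Definition lebesgue_measure2 (R : realType) :
    {measure set (measurableTypeR R * measurableTypeR R) -> \bar R} :=
  (@lebesgue_measure R \x @lebesgue_measure R)%E.

Definition upper_half_plane (R : realType) : set (R * R) :=
  [set z | 0 < z.2].

Definition partial_x (R : realType) (u : R * R -> R) (z : R * R) : R :=
  derive1 (fun y => u (y, z.2)) z.1.

Definition partial_t (R : realType) (u : R * R -> R) (z : R * R) : R :=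
  derive1 (fun s => u (z.1, s)) z.2.

(* `^`() is total: existence of the partial derivatives is stated apart. *)
Definition has_partials (R : realType) (u : R * R -> R) (z : R * R) : Prop :=
  derivable (fun y => u (y, z.2)) z.1 1 /\
  derivable (fun s => u (z.1, s)) z.2 1.

(* Main.v *)
(* Testing the distributional derivative against smooth plateaux whose edges
   shrink to two Lebesgue points shows that f is almost everywhere a constant
   plus the distribution function of a finite signed measure nu = m1 - m2.
   Tonelli then gives u(x,t) = c + \int N((x-z)/sqrt(2t)) dnu(z), with N the
   Gaussian cumulative distribution function, so that
   u_x = \int K_t(x-z) dnu(z) and u_t = - \int (x-z)/(2t) K_t(x-z) dnu(z).
   Both are dominated by t^-a (K_(bt) * |nu|), with a = 0 and a = 1/2
   respectively. Such a function g satisfies |g| <= A t^(-a-1/2) and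
   \int |g(x,t)| dx <= A t^-a: the first bound confines {|g| > l} to t < T(l),
   and Markov's inequality on each slice t = const then bounds its measure by
   (A/l) \int_0^T(l) t^-a dt, which is of order l^-p for p = (3/2)/(a+1/2). *)

Require Import Defs.
From HB Require Import structures.
From mathcomp Require Import all_boot all_order all_algebra.
From mathcomp Require Import all_classical all_reals all_analysis.
From mathcomp Require Import measurable_realfun ring lra.

Set Implicit Arguments.
Unset Strict Implicit.
Unset Printing Implicit Defensive.

Import Order.TTheory GRing.Theory Num.Theory.
Import numFieldNormedType.Exports.

Local Open Scope classical_set_scope.
Local Open Scope ring_scope.

(** * A smooth step *)

(** Each stage carries its derivative as a witness, so closure under sums, products and inverses
    follows by induction on the order, with no formula for iterated derivatives. *)
Fixpoint nderivable (R : realType) (n : nat) (f : R -> R) : Prop :=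
  if n is n'.+1 then
    exists2 g : R -> R, (forall x : R, is_derive x 1 f (g x)) & nderivable n' g
  else True.

Section nderivable_theory.
Context {R : realType}.
Implicit Types (f g : R -> R) (n : nat).

Lemma nderivableW n f : nderivable n.+1 f -> nderivable n f.
Proof.
elim: n f => [//|n IH] f [g fg /IH gn]; by exists g.
Qed.

Lemma nderivable_cst n (c : R) : nderivable n (cst c).
Proof. by elim: n c => [//|n IH] c; exists (cst 0) => // x; exact: is_derive_cst. Qed.

Lemma nderivableD n f g :
  nderivable n f -> nderivable n g -> nderivable n (f \+ g).
Proof.
elim: n f g => [//|n IH] f g [f' ff' f'n] [g' gg' g'n].
by exists (f' \+ g'); [move=> x; exact: is_deriveD|exact: IH].
Qed.

Lemma nderivableM n f g :
  nderivable n f -> nderivable n g -> nderivable n (f \* g).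
Proof.
elim: n f g => [//|n IH] f g nf ng.
have := nderivableW nf; have := nderivableW ng.
case: nf => [f' ff' f'n]; case: ng => [g' gg' g'n] ng nf.
exists ((f \* g') \+ (g \* f')); first by move=> x; exact: is_deriveM.
by apply: nderivableD; exact: IH.
Qed.

(** The derivative of 1/f is -(1/f)^2 f', and the induction hypothesis already gives 1/f one order
    less of differentiability. *)
Lemma nderivableV n f : (forall x, f x != 0) ->
  nderivable n f -> nderivable n (fun x => (f x)^-1).
Proof.
move=> f0; elim: n => [//|n IH] nf.
have nV := IH (nderivableW nf).
case: nf => [f' ff' f'n].
exists (cst (-1) \* ((fun x => (f x)^-1) \* (fun x => (f x)^-1)) \* f').
  move=> x; apply: is_derive_eq (is_deriveV (f0 x) (ff' x)) _.
  by rewrite /= mulN1r -expr2 -exprVn scaleNr mulNr.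
apply: nderivableM => //; apply: nderivableM; last exact: nderivableM.
exact: nderivable_cst.
Qed.

Lemma nderivable_comp_affine n f (a b : R) :
  nderivable n f -> nderivable n (fun x => f (a * x + b)).
Proof.
elim: n f => [//|n IH] f [f' ff' f'n].
exists (cst a \* (fun x => f' (a * x + b))).
  move=> x; rewrite /= mulrC.
  apply: (@is_derive1_comp _ f (fun x => a * x + b)).
  apply: is_derive_eq.
  by rewrite addr0 /GRing.scale /= mulr1.
by apply: nderivableM; [exact: nderivable_cst|exact: IH].
Qed.

(** Passage to the form of smoothness used in [test_function]. *)
Lemma nderivable_derivable f :
  (forall n, nderivable n f) -> forall n x, derivable (derive1n n f) x 1.
Proof.
move=> nf n; have {nf} := nf n.+1; elim: n f => [|n IH] f [g fg ng] x.
  by have [] := fg x.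
rewrite derive1Sn; apply: IH; suff -> : derive1 f = g by [].
by apply/funext => y; rewrite derive1E; apply: derive_val.
Qed.

End nderivable_theory.

(** * Flat functions at the origin and the smooth transition from 0 to 1 *)

Section flat.
Context {R : realType}.

(** The factor x^-n makes the span of this family stable under differentiation: the derivative of
    [flat n] is a combination of [flat n.+2] and [flat n.+1]. *)
Definition flat (n : nat) (x : R) : R :=
  if 0 < x then x^-1 ^+ n * expR (- x^-1) else 0.

Lemma flat_ge0 n x : 0 <= flat n x.
Proof.
rewrite /flat; case: ifPn => // x0.
by rewrite mulr_ge0 ?expR_ge0 ?exprn_ge0// invr_ge0 ltW.
Qed.

Lemma flat_gt0 n x : 0 < x -> 0 < flat n x.
Proof. by move=> x0; rewrite /flat x0 mulr_gt0 ?expR_gt0 ?exprn_gt0// invr_gt0. Qed.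

Lemma flat_le0 n x : x <= 0 -> flat n x = 0.
Proof. by move=> x0; rewrite /flat ltNge x0. Qed.

(** The exponential series gives y^(n+2) / (n+2)! <= e^y, used at y = 1/x. A quadratic bound is what
    forces the derivative at 0 to vanish. *)
Lemma flat_le_sqr n x : flat n x <= (n.+2)`!%:R * x ^+ 2.
Proof.
rewrite /flat; case: ifPn => x0; last by rewrite mulr_ge0 ?sqr_ge0.
have xi0 : 0 < x^-1 by rewrite invr_gt0.
have := expR_ge1Dxn n.+1 (ltW xi0).
rewrite expRN => H.
rewrite ler_pdivrMr ?expR_gt0//.
have fp : (0 : R) < (n.+2)`!%:R by rewrite ltr0n fact_gt0.
have : x^-1 ^+ n.+2 / (n.+2)`!%:R <= expR x^-1 by apply: le_trans H; rewrite lerDr.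
rewrite ler_pdivrMr// => H2.
have -> : x^-1 ^+ n = x ^+ 2 * x^-1 ^+ n.+2.
  by rewrite -[n.+2]addn2 exprD mulrCA -exprMn mulfV ?gt_eqF// expr1n mulr1.
by rewrite [leRHS]mulrAC [leRHS]mulrC ler_pM2l ?exprn_gt0// mulrC.
Qed.

Lemma is_derive_sqr_bound (f : R -> R) (C : R) :
  (forall x, `|f x| <= C * x ^+ 2) -> is_derive (0 : R) 1 f 0.
Proof.
move=> fC.
have f0 : f 0 = 0.
  by apply/eqP; rewrite -normr_le0 (le_trans (fC 0))// expr0n mulr0.
have C0 : 0 <= C by have := le_trans (normr_ge0 _) (fC 1); rewrite expr1n mulr1.
suff H : h^-1 *: ((f \o shift 0) (h *: 1) - f 0) @[h --> 0^'] --> (0 : R).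
  by apply: DeriveDef; [apply/cvg_ex; exists 0|exact: cvg_lim].
apply/cvgr0Pnorm_le => e e0.
near=> h.
have h0 : h != 0 by near: h; exact: nbhs_dnbhs_neq.
rewrite /= f0 subr0 addr0 /GRing.scale /= mulr1 normrM normfV.
rewrite ler_pdivrMl ?normr_gt0//.
apply: le_trans (fC h) _; rewrite -real_normK ?num_real// expr2 mulrCA.
rewrite ler_wpM2l//.
(* Dividing by C + 1 rather than C covers the case C = 0. *)
have : `|h| <= e / (C + 1).
  by near: h; apply: dnbhs0_le; rewrite divr_gt0// ltr_wpDl.
rewrite ler_pdivlMr; last by rewrite ltr_wpDl.
by apply: le_trans; rewrite mulrC ler_wpM2l// lerDl.
Unshelve. all: by end_near. Qed.

(** Away from 0 the function agrees locally with 0 or with the explicit formula; at 0 the quadratic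
    bound applies. *)
Lemma is_derive_flat n (x : R) :
  is_derive x 1 (flat n) (flat n.+2 x - n%:R * flat n.+1 x).
Proof.
have [x0|x0|->] := ltgtP x 0.
- rewrite !flat_le0 ?ltW// mulr0 subr0.
  apply: (@near_eq_is_derive _ _ _ (cst 0)) => //.
  by near=> y; rewrite flat_le0//; near: y; exact: lt_le_nbhsl.
- apply: (@near_eq_is_derive R R R (fun y : R => y^-1 ^+ n * expR (- y^-1))).
    near=> y; rewrite /flat ifT//; near: y; exact: lt_nbhsr.
  rewrite /flat x0.
  have xn0 : x != 0 by rewrite gt_eqF.
  have dV : is_derive x 1 (fun y : R => y^-1) (- x^-1 ^+ 2).
    apply: is_derive_eq; first exact: (@is_deriveV _ id).
    by rewrite /GRing.scale/= mulr1 exprVn.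
  have dE : is_derive x 1 (fun y : R => expR (- y^-1)) (expR (- x^-1) * x^-1 ^+ 2).
    apply: (@is_derive1_comp _ expR (fun y : R => - y^-1)).
    by apply: is_derive_eq; rewrite opprK.
  have := is_deriveM (@is_deriveX _ _ (fun y : R => y^-1) n x 1 _ dV) dE.
  rewrite (_ : _ * _ = fun y : R => y^-1 ^+ n * expR (- y^-1)); last first.
    by apply/funext => y; rewrite !fctE.
  move=> /is_derive_eq; apply; rewrite /GRing.scale /= !fctE.
  by case: n => [|n]; rewrite /= ?exprS; ring.
- rewrite !flat_le0// mulr0 subr0.
  apply: (@is_derive_sqr_bound _ (n.+2)`!%:R) => y.
  by rewrite ger0_norm ?flat_ge0// flat_le_sqr.
Unshelve. all: by end_near. Qed.

Lemma nderivable_flat k n : nderivable k (flat n).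
Proof.
elim: k n => [//|k IH] n.
exists (flat n.+2 \+ (cst (- n%:R) \* flat n.+1)).
  by move=> x; apply: is_derive_eq (is_derive_flat n x) _; rewrite /= mulNr.
by apply: nderivableD => //; apply: nderivableM => //; exact: nderivable_cst.
Qed.

Definition smooth_step (x : R) : R := flat 0 x / (flat 0 x + flat 0 (1 - x)).

(** At least one of x and 1 - x is positive. *)
Let den_gt0 x : 0 < flat 0 x + flat 0 (1 - x).
Proof.
have [x0|x0] := ltP 0 x; first by rewrite ltr_pwDl ?flat_gt0 ?flat_ge0.
by rewrite ltr_wpDl ?flat_ge0// flat_gt0//; lra.
Qed.

Lemma nderivable_smooth_step n : nderivable n smooth_step.
Proof.
apply: nderivableM; first exact: nderivable_flat.
apply: nderivableV; first by move=> x; rewrite gt_eqF.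
apply: nderivableD; first exact: nderivable_flat.
rewrite (_ : (fun _ => _) = fun x => flat 0 (- 1 * x + 1)).
  by apply: nderivable_comp_affine; exact: nderivable_flat.
by apply/funext => x; rewrite mulN1r addrC.
Qed.

Lemma smooth_step_le0 x : x <= 0 -> smooth_step x = 0.
Proof. by move=> x0; rewrite /smooth_step flat_le0// mul0r. Qed.

Lemma smooth_step_ge1 x : 1 <= x -> smooth_step x = 1.
Proof.
move=> x1; rewrite /smooth_step [flat 0 (1 - x)]flat_le0; last by lra.
by rewrite addr0 divff// gt_eqF// flat_gt0//; lra.
Qed.

Lemma smooth_step_bound x : 0 <= smooth_step x <= 1.
Proof.
apply/andP; split; first by rewrite divr_ge0 ?flat_ge0// ltW.
by rewrite ler_pdivrMr// mul1r lerDl flat_ge0.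
Qed.

End flat.

(** * Steps of width e and the plateaux built from them *)

Section rescaled_step.
Context {R : realType}.
Local Notation mu := (@lebesgue_measure R).

Let h : R -> R := smooth_step.
Let eta : R -> R := derive1 h.

Let is_derive_h (x : R) : is_derive x 1 h (eta x).
Proof.
have [g hg _] := nderivable_smooth_step (R := R) 1.
by rewrite /eta derive1E; apply: derivableP; have [] := hg x.
Qed.

Let continuous_eta : continuous eta.
Proof.
have [g hg [g' gg' _]] := nderivable_smooth_step (R := R) 2.
have -> : eta = g by apply/funext => x; rewrite /eta derive1E; apply: derive_val.
by move=> x; apply/differentiable_continuous/derivable1_diffP; have [] := gg' x.
Qed.

(** The step is locally constant outside [0, 1]. *)
Let eta_out x : x \notin `[0, 1] -> eta x = 0.
Proof.
rewrite in_itv /= negb_and -!ltNge => /orP[] x01; rewrite /eta derive1E.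
  rewrite (@near_eq_derive _ _ _ _ (cst (0 : R))) ?derive_cst//.
  near=> y; rewrite /h smooth_step_le0//; near: y; exact: lt_le_nbhsl.
rewrite (@near_eq_derive _ _ _ _ (cst (1 : R))) ?derive_cst//.
near=> y; rewrite /h smooth_step_ge1//; near: y; exact: lt_le_nbhsr.
Unshelve. all: by end_near. Qed.

Let eta_bounded : exists2 C : R, 0 <= C & forall x, `|eta x| <= C.
Proof.
have [||c _ cM] := @EVT_max R (fun x => `|eta x|) 0 1.
- exact: ler01.
- apply: continuous_subspaceT => x.
  by apply: cvg_norm; exact: continuous_eta.
exists `|eta c| => // x; have [x01|x01] := boolP (x \in `[0, 1]); first exact: cM.
by rewrite eta_out// normr0.
Qed.

(** The argument is (x - a) / e, so the rise takes place on [a, a + e]; it is spelled out in the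
    affine shape of [nderivable_comp_affine]. *)
Definition rescaled_step (a e x : R) : R := smooth_step (e^-1 * x + - (e^-1 * a)).

Lemma nderivable_rescaled_step n a e : nderivable n (rescaled_step a e).
Proof. by apply: nderivable_comp_affine; exact: nderivable_smooth_step. Qed.

Lemma rescaled_step_le a e x : 0 < e -> x <= a -> rescaled_step a e x = 0.
Proof.
move=> e0 xa; apply: smooth_step_le0.
by rewrite -mulrBr pmulr_rle0 ?invr_gt0// subr_le0.
Qed.

Lemma rescaled_step_ge a e x : 0 < e -> a + e <= x -> rescaled_step a e x = 1.
Proof.
move=> e0 xa; apply: smooth_step_ge1.
by rewrite -mulrBr mulrC ler_pdivlMr// mul1r lerBrDl.
Qed.

Lemma rescaled_step_bound a e x : 0 <= rescaled_step a e x <= 1.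
Proof. exact: smooth_step_bound. Qed.

Lemma is_derive_rescaled_step (a e x : R) :
  is_derive x 1 (rescaled_step a e) (e^-1 * eta (e^-1 * x + - (e^-1 * a))).
Proof.
rewrite mulrC; apply: (@is_derive1_comp _ h (fun x => e^-1 * x + - (e^-1 * a))).
  exact: is_derive_h.
by apply: is_derive_eq; rewrite ?subr0 ?addr0 /GRing.scale /= mulr1.
Qed.

Lemma derive1_rescaled_step a e x :
  derive1 (rescaled_step a e) x = e^-1 * eta (e^-1 * x + - (e^-1 * a)).
Proof.
by rewrite derive1E; apply: derive_val; exact: is_derive_rescaled_step.
Qed.

Lemma continuous_derive1_rescaled_step a e :
  continuous (derive1 (rescaled_step a e)).
Proof.
have [g hg [g' gg' _]] := nderivable_rescaled_step 2 a e.
have -> : derive1 (rescaled_step a e) = g.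
  by apply/funext => x; rewrite derive1E; apply: derive_val.
by move=> x; apply/differentiable_continuous/derivable1_diffP; have [] := gg' x.
Qed.

Lemma continuous_rescaled_step a e : continuous (rescaled_step a e).
Proof.
have [g hg _] := nderivable_rescaled_step 1 a e.
by move=> x; apply/differentiable_continuous/derivable1_diffP; have [] := hg x.
Qed.

Lemma derive1_rescaled_step_out a e x : 0 < e -> x \notin `[a, a + e] ->
  derive1 (rescaled_step a e) x = 0.
Proof.
move=> e0 xa; rewrite derive1_rescaled_step eta_out ?mulr0//.
apply: contra xa; rewrite !in_itv /= -mulrBr => /andP[].
rewrite pmulr_rge0 ?invr_gt0// subr_ge0 => -> /=.
by rewrite mulrC ler_pdivrMr// mul1r lerBlDl.
Qed.

Lemma derive1_rescaled_step_bounded : exists2 C : R, 0 <= C &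
  forall a e x, 0 < e -> `|derive1 (rescaled_step a e) x| <= C / e.
Proof.
have [C C0 eC] := eta_bounded; exists C => // a e x e0.
rewrite derive1_rescaled_step normrM mulrC ler_pM// ger0_norm//.
by rewrite invr_ge0 ltW.
Qed.

(** Together with the bound C / e and the support [a, a + e], this unit mass makes the derivatives
    an approximate identity at a as e tends to 0. *)
Lemma Rintegral_derive1_rescaled_step a e : 0 < e ->
  \int[mu]_(x in `[a, a + e]) derive1 (rescaled_step a e) x = 1.
Proof.
move=> e0; rewrite /Rintegral.
rewrite (@continuous_FTC2 _ _ (rescaled_step a e)) ?ltrDl//.
- by rewrite rescaled_step_ge// rescaled_step_le//= subr0.
- by apply: continuous_subspaceT; exact: continuous_derive1_rescaled_step.
- split.
  + by move=> x _; have [] := is_derive_rescaled_step a e x.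
  + by apply: cvg_at_right_filter; exact: continuous_rescaled_step.
  + by apply: cvg_at_left_filter; exact: continuous_rescaled_step.
Qed.

Lemma test_function_rescaled_stepB a b e : 0 < e ->
  test_function (rescaled_step a e \- rescaled_step b e).
Proof.
move=> e0; split.
  apply: nderivable_derivable => n; apply: nderivableD.
    exact: nderivable_rescaled_step.
  rewrite (_ : (fun _ => _) = cst (-1) \* rescaled_step b e); last first.
    by apply/funext => x; rewrite /= mulN1r.
  by apply: nderivableM; [exact: nderivable_cst|exact: nderivable_rescaled_step].
(* Left of [c] both steps are 0 and right of [d] both are 1, so the difference is supported in
   [c, d]. *)
set c := Num.min a b; set d := Num.max a b + e.
apply: (@subclosed_compact _ _ `[c, d]).
- exact: closed_closure.
- exact: segment_compact.
- rewrite closureE => x; apply; split; first exact: itv_closed.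
  move=> y /=; apply: contraR; rewrite in_itv /= negb_and -!ltNge.
  rewrite /c /d lt_min -ltrBrDr gt_max => /orP[/andP[ya yb]|].
    by rewrite !rescaled_step_le ?subr0// ltW.
  rewrite !ltrBrDr => /andP[ya yb].
  by rewrite !rescaled_step_ge ?subrr// ltW.
Qed.

End rescaled_step.

(** * Functions whose derivative is a measure *)

Section bv_representation.
Context {R : realType}.
Local Notation mu := (@lebesgue_measure R).
Implicit Types (f : R -> R) (a : R).

Let e_ (n : nat) : R := n.+1%:R^-1.

Let e_gt0 n : 0 < e_ n. Proof. by rewrite invr_gt0. Qed.

Lemma locally_integrable_itv f (a b : R) : locally_integrable setT f ->
  mu.-integrable `[a, b] (EFin \o f).
Proof.
move=> [mf _ lf]; apply/integrableP; split.
  by apply/measurable_EFinP; exact: measurable_funTS.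
by apply: lf => //; exact: segment_compact.
Qed.

Let mul_step_itv f a e : 0 < e ->
  (fun x => f x * derive1 (rescaled_step a e) x) =
  (fun x => f x * derive1 (rescaled_step a e) x) \_ `[a, a + e].
Proof.
move=> e0; apply/funext => x; rewrite patchE; case: ifPn => // xa.
rewrite derive1_rescaled_step_out ?mulr0//.
by apply: contra xa => xa; rewrite inE.
Qed.

Let bounded_step a e (D : set R) : 0 < e ->
  [bounded derive1 (rescaled_step a e) x | x in D].
Proof.
move=> e0; have [C C0 eC] := @derive1_rescaled_step_bounded R.
exists (C / e); split; first exact: num_real.
by move=> M CM x _ /=; rewrite (le_trans (eC _ _ _ e0))// ltW.
Qed.

Let measurable_step a e (D : set R) :
  measurable_fun D (derive1 (rescaled_step a e)).
Proof.
apply: measurable_funTS; apply: continuous_measurable_fun.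
exact: continuous_derive1_rescaled_step.
Qed.

Let integrable_itv_mul_step f a e : locally_integrable setT f -> 0 < e ->
  mu.-integrable `[a, a + e]
    (EFin \o (fun x => f x * derive1 (rescaled_step a e) x)).
Proof.
move=> lf e0; rewrite (_ : _ \o _ =
  (EFin \o f) \* (EFin \o derive1 (rescaled_step a e)))%E; last exact/funext.
apply: integrableMl => //.
- exact: locally_integrable_itv.
- exact: measurable_step.
- exact: bounded_step.
Qed.

Lemma integrable_mul_step f a e : locally_integrable setT f -> 0 < e ->
  mu.-integrable setT (EFin \o (fun x => f x * derive1 (rescaled_step a e) x)).
Proof.
move=> lf e0; rewrite mul_step_itv// -restrict_EFin.
apply: (integrable_mkcond _ _).1 => //.
exact: integrable_itv_mul_step.
Qed.

(** By the unit mass, the error is the integral of f - f(a) against a function of size C / e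
    supported in [a, a + e]; it is controlled by the mean oscillation of f around a, which tends to
    0 at a Lebesgue point. *)
Lemma cvg_mul_step f a : locally_integrable setT f -> lebesgue_pt f a ->
  \int[mu]_x (f x * derive1 (rescaled_step a (e_ n)) x) @[n --> \oo] --> f a.
Proof.
move=> lf fa; have [C C0 eC] := @derive1_rescaled_step_bounded R.
pose I n := \int[mu]_x (f x * derive1 (rescaled_step a (e_ n)) x).
have e0 : (e_ n *+ 2) @[n --> \oo] --> (0 : R).
  rewrite [X in X @ _ --> _](_ : _ = fun n => e_ n + e_ n); last first.
    by apply/funext => n; rewrite mulr2n.
  have := cvgD (@cvg_harmonic R) (@cvg_harmonic R); rewrite addr0; exact.
have d0 : ((4 * C)%:E * davg f a (e_ n *+ 2))%E @[n --> \oo] --> 0%E.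
  suff : davg f a (e_ n *+ 2) @[n --> \oo] --> 0%E.
    by move/(@cvgeZl _ _ _ _ _ (4 * C)%:E isT); rewrite mule0.
  have /cvge_at_rightP := fa; apply; split => // n.
  by rewrite pmulrn_lgt0.
(* The radius is 2e so that the open ball around a contains the closed interval [a, a + e]; the ball
   has length 4e, whence the factor 4 in C / e = 4C / (4e). *)
have key n : (`|I n - f a|%:E <= (4 * C)%:E * davg f a (e_ n *+ 2))%E.
  have en := e_gt0 n; set e := e_ n in en *.
  have If : I n - f a =
      \int[mu]_(x in `[a, a + e]) ((f x - f a) * derive1 (rescaled_step a e) x).
    rewrite /I mul_step_itv// -Rintegral_mkcond.
    rewrite -[X in _ - X]mulr1 -(Rintegral_derive1_rescaled_step a en).
    rewrite -RintegralZl//; last first.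
      apply: continuous_compact_integrable; first exact: segment_compact.
      by apply: continuous_subspaceT; exact: continuous_derive1_rescaled_step.
    rewrite -RintegralB//.
    - by apply: eq_Rintegral => x _; rewrite mulrBl.
    - exact: integrable_itv_mul_step.
    - apply: continuous_compact_integrable; first exact: segment_compact.
      apply: continuous_subspaceT => x; apply: cvgM; first exact: cvg_cst.
      exact: continuous_derive1_rescaled_step.
  have lfa : locally_integrable setT (f \- cst (f a)).
    apply: locally_integrableB => //; split => //; first exact: openT.
    move=> K _ cK; have mK := compact_measurable cK.
    have -> := integral_cst mu mK `|f a|%:E.
    by rewrite lte_mul_pinfty//; exact: compact_finite_measure.
  have mfa : measurable_fun setT (f \- cst (f a)) by case: lfa.
  rewrite If EFin_normr_Rintegral//; last exact: (integrable_itv_mul_step a lfa).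
  apply: le_trans.
    apply: le_abse_integral => //.
    have /measurable_int := integrable_itv_mul_step a lfa en.
    by apply.
  apply: (@le_trans _ _ (\int[mu]_(x in `[a, (a + e)%R]) ((C / e)%:E * `|f x - f a|%:E))%E).
    apply: ge0_le_integral => //.
    - apply/measurable_EFinP; apply: measurableT_comp => //.
      by apply: measurable_funM; [exact: (measurable_funTS mfa)|exact: measurable_step].
    - apply/measurable_EFinP; apply: measurable_funM => //.
      by apply: measurableT_comp => //; exact: (measurable_funTS mfa).
    - move=> x _; rewrite lee_fin normrM mulrC ler_wpM2r//.
      exact: eC.
  rewrite ge0_integralZl//; last first.
    - by rewrite lee_fin divr_ge0// ltW.
    - by apply/measurable_EFinP; apply: measurableT_comp => //; exact: (measurable_funTS mfa).
  have sub : `[a, a + e]%classic `<=` ball a (e *+ 2).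
    rewrite ball_itv => x /=; rewrite !in_itv /= => /andP[ax xa].
    by apply/andP; split; rewrite mulr2n; move: en; lra.
  rewrite /davg /iavg lebesgue_measure_ball; last by rewrite mulrn_wge0// ltW.
  rewrite inver gt_eqF ?pmulrn_lgt0// muleA -EFinM.
  rewrite (_ : 4 * C / (e *+ 2 *+ 2) = C / e); last first.
    rewrite -mulrnA -(mulr_natl e); field; lra.
  apply: lee_pmul => //; first by rewrite lee_fin divr_ge0// ltW.
  - exact: integral_ge0.
  - apply: ge0_subset_integral => //; first exact: measurable_ball.
    by apply/measurable_EFinP; apply: measurableT_comp => //; exact: (measurable_funTS mfa).
apply/subr_cvg0; apply: norm_cvg0.
have : `|I n - f a|%:E @[n --> \oo] --> 0%E.
  apply: (@squeeze_cvge _ _ _ _ (cst 0%E) _ _ _ _ _ d0).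
    by apply: nearW => n; rewrite key andbT lee_fin.
  exact: cvg_cst.
by move/fine_cvg.
Qed.

(** Dominated convergence under the constant 1. The limiting half-line is open because every step
    vanishes at a itself, which matters when m has an atom there. *)
Lemma cvg_integral_step (m : {finite_measure set (measurableTypeR R) -> \bar R}) a :
  \int[m]_x (rescaled_step a (e_ n) x) @[n --> \oo] --> fine (m `]a, +oo[%classic).
Proof.
rewrite /Rintegral; apply: fine_cvg; rewrite fineK ?fin_num_measure//.
rewrite -[X in _ --> X]mul1e -integral_cst//.
rewrite integral_mkcond.
apply: (@dominated_cvg _ _ _ m setT _ _ _ (cst 1%E)) => //.
- move=> n; apply/measurable_EFinP; apply: continuous_measurable_fun.
  exact: continuous_rescaled_step.
- move=> x _; rewrite patchE; have [ax|xa] := ltP a x.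
    rewrite mem_set /= ?in_itv /= ?andbT//.
    have xa0 : 0 < x - a by rewrite subr_gt0.
    apply: cvg_near_cst; near=> n; rewrite rescaled_step_ge// -lerBrDl.
    by apply: ltW; near: n; exact: (near_infty_natSinv_lt (PosNum xa0)).
  rewrite memNset /= ?in_itv /= ?andbT ?ltNge ?xa//.
  by under eq_fun do rewrite rescaled_step_le//; exact: cvg_cst.
- exact: (finite_measure_integrable_cst _ 1).
- move=> n x _; have /andP[h0 h1] := rescaled_step_bound a (e_ n) x.
  by rewrite abse_EFin ger0_norm// lee_fin.
Unshelve. all: by end_near. Qed.

Lemma fine_measure_itvoy (m : {finite_measure set (measurableTypeR R) -> \bar R}) a :
  fine (m `]a, +oo[%classic) = fine (m setT) - fine (m `]-oo, a]%classic).
Proof.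
have -> : m setT = (m `]-oo, a]%classic + m `]a, +oo[%classic)%E.
  by rewrite -setCitvl -measureU ?setUv ?setICr//; exact: measurableC.
by rewrite fineD ?fin_num_measure// addrC addKr.
Qed.

(** Testing on the difference of the steps at two Lebesgue points a and b and letting the width
    shrink expresses f(a) - f(b) through the measures of half-lines. Fixing one of the points gives
    the formula at all Lebesgue points, hence almost everywhere. *)
Lemma bv_ae_representation f
    (m1 m2 : {finite_measure set (measurableTypeR R) -> \bar R}) :
  locally_integrable setT f ->
  (forall phi, test_function phi ->
    \int[mu]_x (f x * derive1 phi x) =
      - (\int[m1]_x phi x - \int[m2]_x phi x)) ->
  exists c, {ae mu, forall x,
    f x = c + (fine (m1 `]-oo, x]%classic) - fine (m2 `]-oo, x]%classic))}.
Proof.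
move=> lf fm.
have key a b : lebesgue_pt f a -> lebesgue_pt f b ->
    f a - f b = - ((fine (m1 `]a, +oo[%classic) - fine (m1 `]b, +oo[%classic)) -
                   (fine (m2 `]a, +oo[%classic) - fine (m2 `]b, +oo[%classic))).
  move=> fa fb.
  have integrable_step (m : {finite_measure set (measurableTypeR R) -> \bar R}) c e :
      m.-integrable setT (EFin \o rescaled_step c e).
    apply: measurable_bounded_integrable => //.
    - by rewrite ltey_eq fin_num_measure.
    - by apply: continuous_measurable_fun; exact: continuous_rescaled_step.
    - exists 1; split; first exact: num_real.
      move=> M M1 x _ /=; have /andP[h0 h1] := rescaled_step_bound c e x.
      by rewrite ger0_norm// (le_trans h1)// ltW.
  have E n : \int[mu]_x (f x * derive1 (rescaled_step a (e_ n)) x) -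
             \int[mu]_x (f x * derive1 (rescaled_step b (e_ n)) x) =
     - ((\int[m1]_x (rescaled_step a (e_ n) x) - \int[m1]_x (rescaled_step b (e_ n) x)) -
        (\int[m2]_x (rescaled_step a (e_ n) x) - \int[m2]_x (rescaled_step b (e_ n) x))).
    rewrite -!RintegralB//; do ?[exact: integrable_mul_step|exact: integrable_step].
    rewrite -fm; last exact: (test_function_rescaled_stepB a b (e_gt0 n)).
    apply: eq_Rintegral => x _; rewrite -mulrBr; congr (_ * _).
    have [da _] := is_derive_rescaled_step a (e_ n) x.
    have [db _] := is_derive_rescaled_step b (e_ n) x.
    by rewrite !derive1E deriveB.
  pose J n := \int[mu]_x (f x * derive1 (rescaled_step a (e_ n)) x) -
    \int[mu]_x (f x * derive1 (rescaled_step b (e_ n)) x).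
  have L : J @ \oo --> f a - f b by apply: cvgB; exact: cvg_mul_step.
  apply: (cvg_unique (@norm_hausdorff R R) L).
  rewrite /= /J; under eq_fun do rewrite E.
  by apply: cvgN; apply: cvgB; apply: cvgB; exact: cvg_integral_step.
have [N [mN N0 sN]] := lebesgue_differentiation lf.
(* Without any Lebesgue point, the null set [N] would contain every real and the claim would hold
   with any constant; this avoids proving that a Lebesgue point exists. *)
have [[a fa]|nofa] := pselect (exists a, lebesgue_pt f a); last first.
  exists 0, N; split => // x _; apply: sN => fx.
  by apply: nofa; exists x.
exists (f a - (fine (m1 `]-oo, a]%classic) - fine (m2 `]-oo, a]%classic))).
exists N; split => // x nx; apply: sN => fx; apply: nx => /=.
have := key _ _ fx fa; rewrite !fine_measure_itvoy => /eqP.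
by rewrite subr_eq => /eqP ->; ring.
Qed.

End bv_representation.

(** * Weak type from slices *)

Section weak_type.
Context {R : realType}.
Local Notation mu := (@lebesgue_measure R).

Lemma weakLp_of_distribution_bound d (T : measurableType d)
    (m : {measure set T -> \bar R}) (D : set T) (p C : R) (g : T -> R) :
  0 < p -> 0 <= C -> measurable_fun D g ->
  (forall l, 0 < l ->
    (m (D `&` [set z | (l < `|g z|)%R]) <= (C * l `^ (- p))%:E)%E) ->
  weakLp m D p g.
Proof.
move=> p0 C0 mg gC; split => //.
apply: (@le_lt_trans _ _ (C `^ p^-1)%:E); last exact: ltry.
apply: ge_ereal_sup => _ [l /= l0 <-].
have pi0 : 0 <= p^-1 by rewrite invr_ge0 ltW.
apply: (@le_trans _ _ (l%:E * (C * l `^ (- p))%:E `^ p^-1))%E.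
  rewrite lee_pmul2l ?fin_numE//.
  apply: gt0_ler_poweR => //.
  - by rewrite in_itv /= measure_ge0 leey.
  - by rewrite in_itv /= lee_fin mulr_ge0 ?powR_ge0 ?leey.
  - exact: gC.
rewrite poweR_EFin -EFinM lee_fin powRM ?powR_ge0// -powRrM mulNr.
rewrite mulfV ?gt_eqF// powR_inv1; last exact: ltW.
by rewrite mulrCA mulfV ?mulr1// gt_eqF.
Qed.

(** Uniqueness of the product measure allows slicing at constant time, whereas [\x] integrates the
    sections at constant x. *)
Lemma product_lebesgue_ysection (A : set (measurableTypeR R * measurableTypeR R)) :
  measurable A -> lebesgue_measure2 R A = (\int[mu]_t mu (ysection A t))%E.
Proof.
move=> mA; rewrite /lebesgue_measure2.
have := @product_measure_unique _ _ _ _ _ mu mu (mu \x^ mu)%E _ A mA.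
by apply => B C mB mC; exact: product_measure2E.
Qed.

(** The integrand may be singular at 0, so the fundamental theorem of calculus is applied on compact
    intervals exhausting ]0, T], followed by monotone convergence. *)
Lemma integral_powRN_le (a T : R) : a < 1 -> 0 < T ->
  (\int[mu]_(t in `]0%R, T]) (t `^ (- a))%:E <= (T `^ (1 - a) / (1 - a))%:E)%E.
Proof.
(* Starting at T / 2 keeps the left endpoint strictly below T for every n. *)
move=> a1 T0; pose F n := `[T * n.+2%:R^-1, T]%classic.
have a1' : 0 < 1 - a by rewrite subr_gt0.
have Fpos n x : F n x -> 0 < x.
  by rewrite /F /= in_itv /= => /andP[+ _]; apply: lt_le_trans; rewrite mulr_gt0.
have -> : `]0%R, T]%classic = \bigcup_n F n.
  apply/seteqP; split => [x|x [n _ Fx]]; rewrite /= in_itv /=.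
    move=> /andP[x0 xT].
    have xT0 : 0 < x / T by rewrite divr_gt0.
    have [n _ nP] := near_infty_natSinv_lt (PosNum xT0).
    exists n => //; rewrite /F /= in_itv /= xT andbT.
    have := nP n (leqnn n) => /= /ltW.
    rewrite ler_pdivlMr// mulrC; apply: le_trans.
    by rewrite ler_pM2l// lef_pV2 ?posrE// ler_nat.
  rewrite (Fpos _ _ Fx) /=; move: Fx; by rewrite /F /= in_itv /= => /andP[].
have mp n : measurable_fun (F n) (fun t : R => (t `^ (- a))%:E).
  by apply/measurable_EFinP/measurable_funTS; exact: measurable_powR.
have H := @ge0_nondecreasing_set_cvg_integral _ (measurableTypeR R) R F
  (fun t : R => (t `^ (- a))%:E) mu _ _ mp _.
have {}H : (\int[mu]_(t in F n) (t `^ (- a))%:E)%E @[n --> \oo] -->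
    (\int[mu]_(t in \bigcup_n F n) (t `^ (- a))%:E)%E.
  apply: H.
  - move=> i j ij; rewrite subsetEset => x; rewrite /F /= !in_itv /= => /andP[ix ->].
    rewrite andbT (le_trans _ ix)// ler_pM2l// lef_pV2 ?posrE// ler_nat.
    by rewrite ltnS.
  - by move=> i; exact: measurable_itv.
  - by move=> *; rewrite lee_fin powR_ge0.
have bound n : (\int[mu]_(t in F n) (t `^ (- a))%:E
    <= (T `^ (1 - a) / (1 - a))%:E)%E.
  have dF (x : R) : 0 < x ->
      is_derive x 1 (fun x => x `^ (1 - a) / (1 - a)) (x `^ (- a)).
    move=> x0; have dp := @is_derive1_powR R (1 - a) x x0.
    apply: is_derive_eq.
    rewrite scaler0 add0r /GRing.scale /= addrAC subrr add0r.
    by rewrite mulrA mulVf ?mul1r// gt_eqF.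
  have Tn0 : 0 < T * n.+2%:R^-1 by rewrite mulr_gt0.
  have TnT : T * n.+2%:R^-1 < T.
    by rewrite -[ltRHS]mulr1 ltr_pM2l// invf_lt1// ltr1n.
  have cont (x b : R) : 0 < x -> {for x, continuous (fun t : R => t `^ b)}.
    move=> x0; apply/differentiable_continuous/derivable1_diffP.
    by have [] := @is_derive1_powR R b x x0.
  rewrite (@continuous_FTC2 _ _ (fun x => x `^ (1 - a) / (1 - a)))//.
  - rewrite -EFinB lee_fin lerBlDr lerDl divr_ge0// ?powR_ge0//; exact: ltW.
  - apply: continuous_in_subspaceT => x /set_mem /Fpos x0; exact: cont.
  - have contF (x : R) : 0 < x -> {for x, continuous (fun x : R => x `^ (1 - a) / (1 - a))}.
      move=> /dF [d _]; exact/differentiable_continuous/derivable1_diffP.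
    split.
    + move=> x; rewrite in_itv /= => /andP[xT _].
      by have [] := dF x (lt_trans Tn0 xT).
    + exact/cvg_at_right_filter/contF.
    + exact/cvg_at_left_filter/contF.
  - move=> x; rewrite in_itv /= => /andP[xT _].
    by rewrite derive1E; apply: derive_val; apply: dF; exact: lt_trans xT.
rewrite -(cvg_lim _ H)//; apply: lime_le; first by apply/cvg_ex; eexists; exact: H.
exact: nearW.
Qed.

Lemma measurable_upper_half_plane :
  measurable (@upper_half_plane R : set (measurableTypeR R * measurableTypeR R)).
Proof.
rewrite (_ : @upper_half_plane R = setT `*` `]0, +oo[%classic).
  exact: measurableX.
by apply/seteqP; split => -[x t] /=; rewrite in_itv /= andbT => // -[].
Qed.

(** The pointwise bound limits how late |g| > l can occur, and the slice bound limits how much of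
    each earlier slice is occupied. *)
Lemma weak_type_of_slices (a A : R) (g : R * R -> R) :
  0 <= a -> a < 1 -> 0 < A ->
  measurable_fun (@upper_half_plane R : set (measurableTypeR R * measurableTypeR R)) g ->
  (forall x t, 0 < t -> `|g (x, t)| <= A * t `^ (- (a + 1 / 2))) ->
  (forall t, 0 < t -> (\int[mu]_x `|g (x, t)|%:E <= (A * t `^ (- a))%:E)%E) ->
  weakLp (lebesgue_measure2 R) (@upper_half_plane R) (3 / 2 / (a + 1 / 2)) g.
Proof.
move=> a0 a1 A0 mg gA intg; set b := a + 1 / 2; set p := 3 / 2 / b.
have b0 : 0 < b by rewrite /b; lra.
have a1' : 0 < 1 - a by rewrite subr_gt0.
have mU := measurable_upper_half_plane.
apply: (@weakLp_of_distribution_bound _ _ _ _ _ (A `^ p / (1 - a))) => //.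
- by rewrite divr_gt0//; lra.
- by rewrite divr_ge0 ?powR_ge0// ltW.
move=> l l0; set E := _ `&` _.
have mE : measurable E.
  have mng : measurable_fun (@upper_half_plane R) (Num.norm \o g) by exact: measurableT_comp.
  have := mng mU `]l, +oo[%classic (measurable_itv _).
  by congr measurable; apply/seteqP; split => z [Uz] /=; rewrite in_itv /= andbT.
rewrite product_lebesgue_ysection//.
have Al0 : 0 < A / l by rewrite divr_gt0.
(* [T] is the time at which the pointwise bound A t^-b equals l; later slices of the superlevel set
   are empty. *)
set T := (A / l) `^ b^-1.
have T0 : 0 < T by exact: powR_gt0.
have sliceE t : 0 < t -> ysection E t = [set x | l < `|g (x, t)|].
  move=> t0; apply/seteqP; split => x; rewrite /ysection /= inE /E /=.
    by case.
  by [].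
have slice0 t : t \notin `]0, T] -> mu (ysection E t) = 0%E.
  rewrite in_itv /= negb_and -!leNgt -ltNge => tT.
  rewrite (_ : ysection E t = set0) ?measure0// -subset0 => x.
  rewrite /ysection /= inE /E /upper_half_plane /= => -[t0 lg].
  case/orP: tT => [|Tt]; first by rewrite leNgt t0.
  have := lt_le_trans lg (gA x t t0); rewrite ltNge => /negP; apply.
  rewrite powRN -/b ler_pdivrMr ?powR_gt0// mulrC -ler_pdivrMr//.
  have -> : A / l = T `^ b by rewrite /T -powRrM mulVf ?powRr1// ?gt_eqF// ltW.
  by apply: ge0_ler_powR; rewrite ?nnegrE ltW.
have slice1 t : 0 < t -> (mu (ysection E t) <= (A / l * t `^ (- a))%:E)%E.
  move=> t0; rewrite sliceE//.
  have mgt : measurable_fun setT (fun x => g (x, t)).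
    apply: (measurable_comp mU _ mg); last exact: measurable_pair2.
    by move=> _ [x _ <-].
  (* Markov's inequality on the slice, stated for the larger set where |g| >= l. *)
  have := @le_integral_abse _ _ _ mu setT measurableT (fun x => (g (x, t))%:E) l _ l0.
  rewrite setTI => H.
  rewrite mulrAC EFinM lee_pdivlMr// muleC.
  apply: le_trans (le_trans (H _) (intg t t0)); last exact/measurable_EFinP.
  rewrite lee_pmul2l//; apply: le_measure; rewrite ?inE.
  - by rewrite -sliceE//; exact: measurable_ysection.
  - rewrite -[X in measurable X]setTI; apply: emeasurable_fun_c_infty => //.
    by apply: measurableT_comp => //; exact/measurable_EFinP.
  - by move=> x /= /ltW.
have -> : (\int[mu]_t mu (ysection E t) = \int[mu]_(t in `]0%R, T]) mu (ysection E t))%E.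
  rewrite [RHS]integral_mkcond; apply: eq_integral => t _.
  rewrite patchE; case: ifPn => // tT; rewrite slice0//.
  by apply: contra tT => tT; rewrite inE.
have my : measurable_fun setT (fun t => mu (ysection E t)).
  exact: measurable_fun_ysection.
apply: (@le_trans _ _ (\int[mu]_(t in `]0%R, T]) ((A / l)%:E * (t `^ (- a))%:E))%E).
  apply: ge0_le_integral => //.
  - exact: measurable_funTS.
  - apply/measurable_EFinP/measurable_funM => //; apply: measurable_funTS.
    exact: measurable_powR.
  - by move=> t; rewrite /= in_itv /= => /andP[t0 _]; rewrite -EFinM; exact: slice1.
rewrite ge0_integralZl//; last first.
- by rewrite lee_fin ltW.
- by move=> t _; rewrite lee_fin powR_ge0.
- by apply/measurable_EFinP/measurable_funTS; exact: measurable_powR.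
apply: le_trans (lee_wpmul2l _ (integral_powRN_le a1 T0)) _.
  by rewrite lee_fin ltW.
rewrite -EFinM lee_fin mulrA [leRHS]mulrAC ler_pM2r ?invr_gt0//.
rewrite /T -powRrM -[X in X * _]powRr1 ?(ltW Al0)// -powRD; last first.
  by apply/implyP => _; rewrite gt_eqF.
(* The first A / l comes from Markov's inequality and the rest from T^(1 - a); the sum of exponents
   is what fixes [p]. *)
have -> : 1 + b^-1 * (1 - a) = p by rewrite /p /b; field; lra.
by rewrite powRM ?invr_ge0 ?(ltW A0) ?(ltW l0)// -powR_inv1 ?(ltW l0)// -powRrM mulN1r.
Qed.

End weak_type.

(** * The heat kernel *)

Section gaussian_cdf.
Context {R : realType}.
Local Notation mu := (@lebesgue_measure R).

Definition gaussian_cdf (r : R) : R :=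
  \int[mu]_(s in `]-oo, r]) normal_pdf 0 1 s.

Lemma EFin_gaussian_cdf r :
  (gaussian_cdf r)%:E = (normal_prob 0 1 `]-oo, r]%classic : \bar R).
Proof.
rewrite /gaussian_cdf /Rintegral fineK// -/(normal_prob 0 1 _).
by rewrite fin_num_measure.
Qed.

Lemma is_derive_gaussian_cdf (r : R) :
  is_derive r 1 gaussian_cdf (normal_pdf 0 1 r).
Proof.
have int1 : mu.-integrable [set` Interval -oo%O (BRight (r + 1))]
    (EFin \o normal_pdf 0 1).
  apply: (integrableS _ _ (subsetT _)) => //.
  exact: integrable_normal_pdf.
have r1 : r < r + 1 by rewrite ltrDl.
have cr : {for r, continuous (@normal_pdf R 0 1)} by exact: continuous_normal_pdf.
have [d dE] := continuous_FTC1 r1 int1 (ltNyr r) cr.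
split; first exact: d.
by rewrite -derive1E; exact: dE.
Qed.

Lemma gaussian_cdf_ge0 r : 0 <= gaussian_cdf r.
Proof. by apply: Rintegral_ge0 => s _; exact: normal_pdf_ge0. Qed.

Lemma gaussian_cdf_le1 r : gaussian_cdf r <= 1.
Proof. by rewrite -lee_fin EFin_gaussian_cdf; exact: probability_le1. Qed.

(** Regarded as a random variable under the standard normal law, the identity has [gaussian_cdf] as
    its distribution function, which yields the limit at -oo. *)
Let idTR : measurableTypeR R -> R := idfun.

#[local] HB.instance Definition _ :=
  @isMeasurableFun.Build _ _ _ _ idTR (@measurable_id _ _ setT).

Lemma cvg_gaussian_cdfNy : gaussian_cdf r @[r --> -oo] --> 0.
Proof.
have /fine_cvg := cvg_cdfNy0 (idTR : {RV (@normal_prob R 0 1) >-> R}).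
by [].
Qed.

End gaussian_cdf.

(** * The heat kernel as a normal density, and its pointwise bounds *)

Section heat_kernel_facts.
Context {R : realType}.
Local Notation mu := (@lebesgue_measure R).
Implicit Types t x y z w : R.

Lemma heat_kernel_ge0 t w : 0 <= heat_kernel t w.
Proof. by rewrite mulr_ge0 ?invr_ge0 ?expR_ge0. Qed.

Let sqrt2t_gt0 t : 0 < t -> 0 < Num.sqrt (2 * t).
Proof. by move=> t0; rewrite sqrtr_gt0 mulr_gt0. Qed.

(** K_t is the centred normal density of variance 2t. This rescaled form suits the chain rule for
    [gaussian_cdf]. *)
Lemma heat_kernelE_std t w : 0 < t ->
  heat_kernel t w = normal_pdf 0 1 (w / Num.sqrt (2 * t)) / Num.sqrt (2 * t).
Proof.
move=> t0; have s0 := sqrt2t_gt0 t0.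
rewrite normal_pdfE ?oner_neq0// /normal_peak /normal_fun /heat_kernel.
rewrite [RHS]mulrAC -invfM -sqrtrM; last by rewrite expr1n mul1r mulrn_wge0// pi_ge0.
congr ((Num.sqrt _)^-1 * expR _).
  by rewrite -mulr_natl; ring.
rewrite subr0 exprMn exprVn sqr_sqrtr ?mulr_ge0 ?ltW//.
field; rewrite gt_eqF//.
Qed.

Lemma heat_kernel_normal_pdf t x y : 0 < t ->
  heat_kernel t (x - y) = normal_pdf x (Num.sqrt (2 * t)) y.
Proof.
move=> t0; have s0 := sqrt2t_gt0 t0.
rewrite normal_pdfE ?gt_eqF// /normal_peak /normal_fun /heat_kernel.
rewrite sqr_sqrtr ?mulr_ge0 ?ltW//.
congr ((Num.sqrt _)^-1 * expR _).
  by rewrite -mulr_natl; ring.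
by rewrite -mulr_natl; field; rewrite gt_eqF.
Qed.

Lemma heat_kernelN t w : heat_kernel t (- w) = heat_kernel t w.
Proof. by rewrite /heat_kernel sqrrN. Qed.

Lemma continuous_heat_kernel t x : 0 < t ->
  continuous (fun y => heat_kernel t (x - y)).
Proof.
move=> t0; rewrite (_ : (fun _ => _) = normal_pdf x (Num.sqrt (2 * t))).
  by apply: continuous_normal_pdf; rewrite gt_eqF// sqrt2t_gt0.
by apply/funext => y; exact: heat_kernel_normal_pdf.
Qed.

Lemma measurable_heat_kernel t x : 0 < t ->
  measurable_fun setT (fun y => heat_kernel t (x - y)).
Proof.
move=> t0; under eq_fun do rewrite heat_kernel_normal_pdf//.
exact: measurable_normal_pdf.
Qed.

Lemma integral_heat_kernel t x : 0 < t ->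
  (\int[mu]_y (heat_kernel t (x - y))%:E = 1)%E.
Proof.
move=> t0; under eq_integral do rewrite heat_kernel_normal_pdf//.
exact: integral_normal_pdf.
Qed.

Lemma integral_heat_kernel_shift t z : 0 < t ->
  (\int[mu]_x (heat_kernel t (x - z))%:E = 1)%E.
Proof.
move=> t0; under eq_integral do rewrite -heat_kernelN opprB.
exact: integral_heat_kernel.
Qed.

Lemma integrable_heat_kernel t x : 0 < t ->
  mu.-integrable setT (EFin \o (fun y => heat_kernel t (x - y))).
Proof.
move=> t0; rewrite (_ : _ \o _ = fun y => (normal_pdf x (Num.sqrt (2 * t)) y)%:E).
  exact: integrable_normal_pdf.
by apply/funext => y /=; rewrite heat_kernel_normal_pdf.
Qed.

(** The peak value is (4 pi t)^(-1/2), and 4 pi >= 1. *)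
Lemma heat_kernel_le t w : 0 < t -> heat_kernel t w <= t `^ (- (1 / 2)).
Proof.
move=> t0; rewrite powRN div1r powR12_sqrt ?(ltW t0)//.
apply: (@le_trans _ _ (Num.sqrt (4 * pi * t))^-1).
  rewrite /heat_kernel ler_piMr ?invr_ge0// -[leRHS]expR0 ler_expR mulNr oppr_le0.
  by rewrite mulr_ge0 ?sqr_ge0// invr_ge0 mulr_ge0// ltW.
have p2 := pi_ge2 R.
rewrite lef_pV2 ?posrE ?sqrtr_gt0 ?mulr_gt0 ?pi_gt0//.
apply: ler_wsqrtr; rewrite ler_peMl ?(ltW t0)//; lra.
Qed.

(* With q = w^2/(8t), AM-GM gives |w| / (2 sqrt t) <= 1 + q <= e^q, and one
   factor e^-q turns K_t into a multiple of K_(2t). *)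
Lemma heat_kernel_deriv_le t w : 0 < t ->
  `|w / (2 * t) * heat_kernel t w| <=
    2 * t `^ (- (1 / 2)) * heat_kernel (2 * t) w.
Proof.
move=> t0; rewrite powRN div1r powR12_sqrt ?(ltW t0)//.
rewrite normrM (ger0_norm (heat_kernel_ge0 _ _)) /heat_kernel.
have -> : 4 * pi * (2 * t) = 2 * (4 * pi * t) by ring.
rewrite (sqrtrM _ (_ : 0 <= 2))//.
set r := Num.sqrt t; set c := Num.sqrt (4 * pi * t).
have r0 : 0 < r by rewrite sqrtr_gt0.
have tr : t = r ^+ 2 by rewrite sqr_sqrtr// ltW.
have c0 : 0 < c by rewrite sqrtr_gt0 !mulr_gt0// pi_gt0.
set q := w ^+ 2 / (8 * t).
have -> : - w ^+ 2 / (4 * t) = - q - q by rewrite /q; field; rewrite gt_eqF.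
have -> : - w ^+ 2 / (4 * (2 * t)) = - q by rewrite /q; field; rewrite gt_eqF.
rewrite expRD !mulrA ler_pM2r ?expR_gt0//.
rewrite expRN ler_pdivrMr ?expR_gt0//.
have s20 : 0 < Num.sqrt 2 :> R by rewrite sqrtr_gt0.
have s2 : Num.sqrt 2 <= 2 :> R.
  rewrite -[leRHS]ger0_norm// -[leRHS]sqrtr_sqr; apply: ler_wsqrtr; lra.
set v := `|w| / r.
have vq : v / 2 <= expR q.
  apply: le_trans (expR_ge1Dx q).
  have -> : q = v ^+ 2 / 8.
    by rewrite /q /v exprMn real_normK ?num_real// tr; field; rewrite gt_eqF.
  (* What remains is v/2 <= 1 + v^2/8, a quadratic with negative discriminant. *)
  nra.
have -> : `|w / (2 * t)| / c = v / 2 * (r * c)^-1.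
  rewrite normrM normfV (gtr0_norm (mulr_gt0 _ t0))// /v tr; field.
  by rewrite !gt_eqF.
have -> : 2 / r / (Num.sqrt 2 * c) * expR q =
    2 / Num.sqrt 2 * (expR q * (r * c)^-1).
  by field; rewrite !gt_eqF.
apply: (@le_trans _ _ (expR q * (r * c)^-1)).
  by rewrite ler_pM2r// invr_gt0 mulr_gt0.
(* The constant 2 absorbs the factor sqrt 2 lost between the normalisations of K_t and K_(2t). *)
apply: ler_peMl; last by rewrite ler_pdivlMr ?mul1r.
by rewrite mulr_ge0 ?expR_ge0// invr_ge0 ltW// mulr_gt0.
Qed.

End heat_kernel_facts.

(** * The heat evolution of a unit step *)

Section heat_cdf.
Context {R : realType}.
Local Notation mu := (@lebesgue_measure R).
Implicit Types t x y z w : R.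

(** For t > 0 this is the heat evolution at (x, t) of the indicator of [z, +oo[, as
    [integral_heat_kernel_itv] shows. *)
Definition heat_cdf t x z := gaussian_cdf ((x - z) / Num.sqrt (2 * t)).

Lemma is_derive_heat_cdf_x t x z : 0 < t ->
  is_derive x 1 (fun y => heat_cdf t y z) (heat_kernel t (x - z)).
Proof.
move=> t0; rewrite heat_kernelE_std//; set s := Num.sqrt (2 * t).
apply: (@is_derive1_comp _ gaussian_cdf (fun y => (y - z) / s)).
  exact: is_derive_gaussian_cdf.
by apply: is_derive_eq; rewrite scaler0 add0r subr0 /GRing.scale /= mulr1.
Qed.

(** Provides the antiderivative of the kernel in its second variable. *)
Lemma is_derive_heat_cdf_z t x z : 0 < t ->
  is_derive z 1 (fun y => - heat_cdf t x y) (heat_kernel t (x - z)).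
Proof.
move=> t0; rewrite heat_kernelE_std//; set s := Num.sqrt (2 * t).
suff H : is_derive z 1 (fun y => heat_cdf t x y)
    (- (normal_pdf 0 1 ((x - z) / s) / s)).
  by apply: is_derive_eq; rewrite opprK.
rewrite -mulrN; apply: (@is_derive1_comp _ gaussian_cdf (fun y => (x - y) / s)).
  exact: is_derive_gaussian_cdf.
by apply: is_derive_eq; rewrite scaler0 !add0r /GRing.scale /= ?mul1r mulrN1.
Qed.

Lemma is_derive_heat_cdf_t t x z : 0 < t ->
  is_derive t 1 (fun s => heat_cdf s x z)
    (- ((x - z) / (2 * t) * heat_kernel t (x - z))).
Proof.
move=> t0; rewrite heat_kernelE_std//.
have t20 : 0 < 2 * t by rewrite mulr_gt0.
have s0 : 0 < Num.sqrt (2 * t) by rewrite sqrtr_gt0.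
have dsq : is_derive t 1 (fun s : R => Num.sqrt (2 * s)) (Num.sqrt (2 * t))^-1.
  rewrite (_ : _^-1 = (2 * Num.sqrt (2 * t))^-1 * 2); last first.
    by field; rewrite gt_eqF.
  apply: (@is_derive1_comp _ Num.sqrt (fun s : R => 2 * s)).
    exact: is_derive1_sqrt.
  by apply: is_derive_eq; rewrite /GRing.scale /= mulr1.
have dV := @is_deriveV R (fun s => Num.sqrt (2 * s)) t _ 1 (lt0r_neq0 s0) dsq.
rewrite (_ : - _ = normal_pdf 0 1 ((x - z) / Num.sqrt (2 * t)) *
   ((x - z) * (- (Num.sqrt (2 * t)) ^- 2 *: (Num.sqrt (2 * t))^-1))).
  apply: (@is_derive1_comp _ gaussian_cdf (fun s => (x - z) / Num.sqrt (2 * s))).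
  exact: is_derive_gaussian_cdf.
rewrite sqr_sqrtr ?(ltW t20)// /GRing.scale /=.
by field; rewrite !gt_eqF.
Qed.

Lemma heat_cdf_bound t x z : 0 <= heat_cdf t x z <= 1.
Proof. by rewrite gaussian_cdf_ge0 gaussian_cdf_le1. Qed.

Lemma integral_heat_kernel_itv t x z : 0 < t ->
  (\int[mu]_(y in `[z, +oo[) (heat_kernel t (x - y))%:E = (heat_cdf t x z)%:E)%E.
Proof.
move=> t0; have s0 : 0 < Num.sqrt (2 * t) by rewrite sqrtr_gt0 mulr_gt0.
rewrite (@ge0_continuous_FTC2y _ _ (fun y => - heat_cdf t x y) z 0).
- by rewrite EFinN oppeK add0e.
- by move=> y _; exact: heat_kernel_ge0.
- by apply: continuous_subspaceT; exact: continuous_heat_kernel.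
(* As y tends to +oo, (x - y) / sqrt(2t) tends to -oo, so the antiderivative tends to 0. *)
- rewrite -[X in _ --> X]oppr0; apply: cvgN.
  apply: (@cvg_comp _ _ _ (fun y => (x - y) / Num.sqrt (2 * t)) gaussian_cdf).
    2: exact: cvg_gaussian_cdfNy.
  apply/cvgrNyPle => M; near=> y.
  rewrite ler_pdivrMr// lerBlDr -lerBlDl.
  by near: y; apply: nbhs_pinfty_ge; exact: num_real.
- by move=> y _; have [] := is_derive_heat_cdf_z x y t0.
- have [dz _] := is_derive_heat_cdf_z x z t0.
  apply: cvg_at_right_filter.
  exact: (differentiable_continuous ((derivable1_diffP _ _).1 dz)).
- by move=> y _; rewrite derive1E; apply: derive_val; exact: is_derive_heat_cdf_z.
Unshelve. all: by end_near. Qed.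

End heat_cdf.

(** * Superposition of step evolutions against a finite measure *)

Section heat_potential_of_measure.
Context {R : realType}.
Local Notation mu := (@lebesgue_measure R).
Variable m : {finite_measure set (measurableTypeR R) -> \bar R}.
Implicit Types t x y z w : R.

(** Tonelli for the kernel restricted to z <= y: integrating first in z gives the distribution
    function of m at y, integrating first in y gives the kernel mass of [z, +oo[. *)
Lemma heat_semigroup_distribution t x : 0 < t ->
  \int[mu]_y (heat_kernel t (x - y) * fine (m `]-oo, y]%classic)) =
  \int[m]_z heat_cdf t x z.
Proof.
move=> t0; congr fine.
pose A : set (measurableTypeR R * measurableTypeR R) := [set p | p.2 <= p.1].
have mA : measurable A.
  rewrite -[A]setTI.
  have := @measurable_fun_ler _ _ R setT
    (@snd (measurableTypeR R) (measurableTypeR R))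
    (@fst (measurableTypeR R) (measurableTypeR R)) measurable_snd measurable_fst.
  by move=> /(_ measurableT [set true] _); apply.
have A1 y z : \1_A (y, z) = \1_(`]-oo, y]%classic) z :> R.
  rewrite !indicE (_ : ((y, z) \in A) = (z \in `]-oo, y]%classic))//.
have A2 y z : \1_A (y, z) = \1_(`[z, +oo[%classic) y :> R.
  rewrite !indicE (_ : ((y, z) \in A) = (y \in `[z, +oo[%classic))//.
  by apply/idP/idP; rewrite !inE /A /= in_itv /= andbT.
pose f (p : measurableTypeR R * measurableTypeR R) : \bar R :=
  (heat_kernel t (x - p.1) * \1_A p)%:E.
have mf : measurable_fun setT f.
  apply/measurable_EFinP; apply: measurable_funM; last exact: measurable_indic.
  apply: (@measurableT_comp _ _ _ _ _ _ (fun y => heat_kernel t (x - y))) => //.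
  exact: measurable_heat_kernel.
have f0 p : (0 <= f p)%E by rewrite lee_fin mulr_ge0 ?heat_kernel_ge0.
transitivity (\int[mu]_y \int[m]_z f (y, z))%E.
  apply: eq_integral => y _; rewrite /f /=.
  under eq_integral do rewrite EFinM.
  under eq_integral do rewrite A1.
  rewrite ge0_integralZl//; last 2 first.
  - by apply/measurable_EFinP; exact: measurable_indic.
  - by rewrite lee_fin heat_kernel_ge0.
  by rewrite integral_indic// setIT EFinM fineK ?fin_num_measure.
rewrite (@fubini_tonelli _ _ _ _ _ mu m f)//.
apply: eq_integral => z _; rewrite -integral_heat_kernel_itv//.
rewrite [RHS]integral_mkcond; apply: eq_integral => y _.
rewrite /f /= A2 patchE indicE.
by case: (y \in _); rewrite ?mulr1 ?mulr0.
Qed.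

Lemma integrable_heat_cdf t x : 0 < t ->
  m.-integrable setT (EFin \o heat_cdf t x).
Proof.
move=> t0; apply: measurable_bounded_integrable => //.
- by rewrite ltey_eq fin_num_measure.
- rewrite (_ : heat_cdf t x = \- (fun z => - heat_cdf t x z)); last first.
    by apply/funext => z /=; rewrite opprK.
  apply: continuous_measurable_fun => z.
  have [dz _] := is_derive_heat_cdf_z x z t0.
  apply: continuousN.
  exact: (differentiable_continuous ((derivable1_diffP _ _).1 dz)).
- exists 1; split; first exact: num_real.
  move=> M M1 z _ /=; have /andP[h0 h1] := heat_cdf_bound t x z.
  by rewrite ger0_norm// (le_trans h1)// ltW.
Qed.

(** Differentiation under the integral, dominated by the constant t^(-1/2), which is integrable
    because m is finite. *)
Lemma is_derive_integral_heat_cdf_x t x : 0 < t ->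
  is_derive x 1 (fun y => \int[m]_z heat_cdf t y z)
    (\int[m]_z heat_kernel t (x - z)).
Proof.
move=> t0; set C := t `^ (- (1 / 2)).
have Ix : `]x - 1, x + 1[%classic x by rewrite /= in_itv /=; apply/andP; split; lra.
have dx y z : is_derive y 1 (fun y => heat_cdf t y z) (heat_kernel t (y - z)).
  exact: is_derive_heat_cdf_x.
have d1 y z : partial1of2 (heat_cdf t) y z = heat_kernel t (y - z).
  by rewrite partial1of2E; apply: derive_val.
have intC := finite_measure_integrable_cst m C measurableT.
have C0 (y : R) : 0 <= cst C y by exact: powR_ge0.
have int y : `]x - 1, x + 1[%classic y -> m.-integrable setT (EFin \o heat_cdf t y).
  by move=> _; exact: integrable_heat_cdf.
have der y z : `]x - 1, x + 1[%classic y -> setT z ->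
    derivable (fun y => heat_cdf t y z) y 1.
  by move=> _ _; have [] := dx y z.
have ub y z : `]x - 1, x + 1[%classic y -> setT z ->
    `|partial1of2 (heat_cdf t) y z| <= cst C z.
  by move=> _ _; rewrite d1 ger0_norm ?heat_kernel_ge0// heat_kernel_le.
split; first exact: (derivable_under_integral measurableT Ix int der C0 intC ub).
rewrite -derive1E (differentiation_under_integral measurableT Ix int der C0 intC ub).
by apply: eq_Rintegral => z _; exact: d1.
Qed.

Lemma is_derive_integral_heat_cdf_t t x : 0 < t ->
  is_derive t 1 (fun s => \int[m]_z heat_cdf s x z)
    (\int[m]_z - ((x - z) / (2 * t) * heat_kernel t (x - z))).
Proof.
(* On [I] the time derivative is at most 2 s^(-1/2) K_(2s) <= 2 / s, and s > t / 2 gives the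
   constant 4 / t. *)
move=> t0; pose I := `]t / 2, t + 1[%classic; set C := 4 / t.
have It : I t by rewrite /I /= in_itv /=; apply/andP; split; lra.
have I0 s : I s -> 0 < s /\ t / 2 < s.
  by rewrite /I /= in_itv /= => /andP[ts _]; split => //; lra.
have dt s z : I s -> is_derive s 1 (fun s => heat_cdf s x z)
    (- ((x - z) / (2 * s) * heat_kernel s (x - z))).
  by move=> /I0[s0 _]; exact: is_derive_heat_cdf_t.
pose g s := heat_cdf s x.
have d1 s z : I s -> partial1of2 g s z =
    - ((x - z) / (2 * s) * heat_kernel s (x - z)).
  by move=> Is; rewrite partial1of2E; have [] := dt s z Is.
have intC := finite_measure_integrable_cst m C measurableT.
have C0 (y : R) : 0 <= cst C y by rewrite /= divr_ge0// ltW.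
have int s : I s -> m.-integrable setT (EFin \o g s).
  by move=> /I0[s0 _]; exact: integrable_heat_cdf.
have der s z : I s -> setT z -> derivable (fun s => g s z) s 1.
  by move=> Is _; have [] := dt s z Is.
have ub s z : I s -> setT z -> `|partial1of2 g s z| <= cst C z.
  move=> Is _; have [s0 ts] := I0 s Is; rewrite d1// normrN /=.
  apply: le_trans (heat_kernel_deriv_le _ s0) _.
  have s20 : 0 < 2 * s by rewrite mulr_gt0.
  apply: (@le_trans _ _ (2 * s `^ (- (1 / 2)) * s `^ (- (1 / 2)))).
    rewrite ler_wpM2l ?mulr_ge0 ?powR_ge0//.
    apply: le_trans (heat_kernel_le _ s20) _.
    rewrite !powRN lef_pV2 ?posrE ?powR_gt0//.
    by apply: ge0_ler_powR; rewrite ?nnegrE; lra.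
  rewrite -mulrA -powRD; last by apply/implyP => _; rewrite gt_eqF.
  rewrite (_ : - (1 / 2) - 1 / 2 = -1); last by field.
  rewrite powR_inv1 ?(ltW s0)// /C ler_pdivlMr// mulrAC ler_pdivrMr//; lra.
split; first exact: (derivable_under_integral measurableT It int der C0 intC ub).
rewrite -derive1E (differentiation_under_integral measurableT It int der C0 intC ub).
by apply: eq_Rintegral => z _; exact: d1.
Qed.

End heat_potential_of_measure.

(** * Heat potentials of finite measures *)

(** Tonelli's theorem gives measurability for the positive and the negative part of the integrand
    separately. *)
Lemma measurable_Rintegral_param d1 d2 (T1 : measurableType d1)
    (T2 : measurableType d2) (R : realType)
    (m : {finite_measure set T2 -> \bar R}) (k : T1 * T2 -> R) :
  measurable_fun setT k ->
  measurable_fun setT (fun x => \int[m]_y k (x, y)).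
Proof.
move=> mk; have mek : measurable_fun setT (EFin \o k) by exact/measurable_EFinP.
rewrite /Rintegral; apply: measurableT_comp => //.
rewrite (_ : (fun _ => _) = fun x => (fubini_F m (EFin \o k)^\+ x -
    fubini_F m (EFin \o k)^\- x)%E); last first.
  apply/funext => x; rewrite integralE.
  by congr (_ - _)%E; apply: eq_integral => y _; rewrite ?funeposE ?funenegE.
apply: emeasurable_funB; apply: measurable_fun_fubini_tonelli_F => //.
- exact: measurable_funepos.
- exact: measurable_funeneg.
Qed.

Section heat_potential.
Context {R : realType}.
Local Notation mu := (@lebesgue_measure R).
Implicit Types (m : {finite_measure set (measurableTypeR R) -> \bar R}).
Implicit Types (t x y z w : R).

Lemma continuous_heat_kernel0 t : 0 < t -> continuous (heat_kernel t).
Proof.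
move=> t0; rewrite (_ : heat_kernel t = fun y => heat_kernel t (0 - y)).
  exact: continuous_heat_kernel.
by apply/funext => y; rewrite sub0r heat_kernelN.
Qed.

Definition heat_potential m t x : R := \int[m]_z heat_kernel t (x - z).

Lemma bounded_integrable_finite m (k : R -> R) (C : R) :
  measurable_fun setT k -> (forall z, `|k z| <= C) ->
  m.-integrable setT (EFin \o k).
Proof.
move=> mk kC; apply: measurable_bounded_integrable => //.
  by rewrite ltey_eq fin_num_measure.
exists C; split; first exact: num_real.
by move=> M CM z _ /=; rewrite (le_trans (kC z))// ltW.
Qed.

Lemma integrable_heat_kernel_finite m t x : 0 < t ->
  m.-integrable setT (EFin \o (fun z => heat_kernel t (x - z))).
Proof.
move=> t0; apply: (@bounded_integrable_finite _ _ (t `^ (- (1 / 2)))).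
  exact: measurable_heat_kernel.
by move=> z; rewrite ger0_norm ?heat_kernel_ge0// heat_kernel_le.
Qed.

Lemma heat_potential_ge0 m t x : 0 <= heat_potential m t x.
Proof. by apply: Rintegral_ge0 => z _; exact: heat_kernel_ge0. Qed.

Lemma heat_potential_le m t x : 0 < t ->
  heat_potential m t x <= fine (m setT) * t `^ (- (1 / 2)).
Proof.
move=> t0; rewrite mulrC -Rintegral_cst//; apply: le_Rintegral => //.
- exact: integrable_heat_kernel_finite.
- exact: finite_measure_integrable_cst.
- by move=> z _; exact: heat_kernel_le.
Qed.

Lemma EFin_heat_potential m t x : 0 < t ->
  (heat_potential m t x)%:E = (\int[m]_z (heat_kernel t (x - z))%:E)%E.
Proof.
move=> t0; rewrite fineK//; apply: integrable_fin_num => //.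
exact: integrable_heat_kernel_finite.
Qed.

Lemma measurable_heat_kernel_sub t : 0 < t ->
  measurable_fun (setT : set (measurableTypeR R * measurableTypeR R))
    (fun p => heat_kernel t (p.1 - p.2)).
Proof.
move=> t0; apply: (@measurableT_comp _ _ _ _ _ _ (heat_kernel t)).
  by apply: continuous_measurable_fun; exact: continuous_heat_kernel0.
by apply: measurable_funB; [exact: measurable_fst|exact: measurable_snd].
Qed.

Lemma measurable_heat_potential m t : 0 < t ->
  measurable_fun setT (heat_potential m t).
Proof.
move=> t0; have := measurable_Rintegral_param m (measurable_heat_kernel_sub t0).
by [].
Qed.

(** By Tonelli, since the kernel also has unit mass in x for each fixed z. *)
Lemma integral_heat_potential m t : 0 < t ->
  (\int[mu]_x (heat_potential m t x)%:E = m setT)%E.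
Proof.
move=> t0; under eq_integral do rewrite EFin_heat_potential//.
rewrite (@fubini_tonelli _ _ _ _ _ mu m
  (fun p => (heat_kernel t (p.1 - p.2))%:E)).
- under eq_integral do rewrite integral_heat_kernel_shift//.
  by rewrite integral_cst// mul1e.
- by apply/measurable_EFinP; exact: measurable_heat_kernel_sub.
- by move=> p; rewrite lee_fin heat_kernel_ge0.
Qed.

(** The two potentials have height at most a multiple of t^(-1/2) and a space integral independent
    of t, which supplies both hypotheses of [weak_type_of_slices]. *)
Lemma weak_type_heat_potential m1 m2 (a b B : R) (g : R * R -> R) :
  0 <= a -> a < 1 -> 0 < B -> 1 <= b ->
  measurable_fun (@upper_half_plane R : set (measurableTypeR R * measurableTypeR R)) g ->
  (forall x t, 0 < t -> `|g (x, t)| <= B * t `^ (- a) *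
     (heat_potential m1 (b * t) x + heat_potential m2 (b * t) x)) ->
  weakLp (lebesgue_measure2 R) (@upper_half_plane R) (3 / 2 / (a + 1 / 2)) g.
Proof.
move=> a0 a1 B0 b1 mg gB.
set M := fine (m1 setT) + fine (m2 setT).
have M0 : 0 <= M by rewrite addr_ge0// fine_ge0.
have M10 : 0 < M + 1 by rewrite ltr_wpDl.
have b0 : 0 < b by exact: lt_le_trans b1.
(* The added 1 keeps the constant positive when both measures are zero. *)
apply: (@weak_type_of_slices _ a (B * (M + 1))) => //; first by rewrite mulr_gt0.
- move=> x t t0; apply: le_trans (gB x t t0) _.
  have bt0 : 0 < b * t by rewrite mulr_gt0.
  rewrite opprD powRD; last by apply/implyP => _; rewrite gt_eqF.
  rewrite -!mulrA ler_pM2l// mulrCA ler_wpM2l ?powR_ge0//.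
  apply: (@le_trans _ _ (M * (b * t) `^ (- (1 / 2)))).
    by rewrite mulrDl lerD// heat_potential_le.
  apply: ler_pM; rewrite ?powR_ge0 ?lerDl//.
  (* Here b >= 1 is used: (bt)^(-1/2) <= t^(-1/2). *)
  rewrite !powRN lef_pV2 ?posrE ?powR_gt0//.
  apply: ge0_ler_powR; rewrite ?nnegrE ?(ltW bt0) ?(ltW t0)//.
  by rewrite ler_peMl// ltW.
- move=> t t0; have bt0 : 0 < b * t by rewrite mulr_gt0.
  have Bt0 : 0 <= B * t `^ (- a) by rewrite mulr_ge0 ?powR_ge0// ltW.
  have mJ m := measurable_heat_potential m bt0.
  apply: (@le_trans _ _ (\int[mu]_x ((B * t `^ (- a))%:E *
      ((heat_potential m1 (b * t) x)%:E + (heat_potential m2 (b * t) x)%:E)))%E).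
    apply: ge0_le_integral => //.
    + apply/measurable_EFinP; apply: measurableT_comp => //.
      apply: (measurable_comp measurable_upper_half_plane _ mg); last exact: measurable_pair2.
      by move=> _ [x _ <-].
    + apply/measurable_EFinP; apply: measurable_funM => //.
      by apply: measurable_funD; exact: mJ.
    + by move=> x _; rewrite -EFinD -EFinM lee_fin gB.
  rewrite ge0_integralZl//; first last.
  + by move=> x _; rewrite adde_ge0// lee_fin heat_potential_ge0.
  + apply/measurable_EFinP; apply: measurable_funD; exact: mJ.
  rewrite ge0_integralD//; first last.
  + by apply/measurable_EFinP; exact: mJ.
  + by move=> x _; rewrite lee_fin heat_potential_ge0.
  + by apply/measurable_EFinP; exact: mJ.
  + by move=> x _; rewrite lee_fin heat_potential_ge0.
  rewrite !integral_heat_potential//.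
  rewrite -[m1 setT]fineK ?fin_num_measure// -[m2 setT]fineK ?fin_num_measure//.
  by rewrite -EFinD -EFinM lee_fin [leRHS]mulrAC ler_wpM2l// -/M lerDl.
Qed.

Lemma measurable_fine_distribution m :
  measurable_fun setT (fun y => fine (m `]-oo, y]%classic)).
Proof.
apply: nondecreasing_measurable => // x y xy.
rewrite fine_le ?fin_num_measure//; apply: le_measure; rewrite ?inE//.
by move=> z /=; rewrite !in_itv /= => /le_trans; apply.
Qed.

(** The integral ignores null sets, so f can be replaced by its representation. The constant
    survives because the kernel has unit mass; the other terms are integrable because distribution
    functions are bounded by the total mass. *)
Lemma heat_semigroup_bv m1 m2 (f : R -> R) (c t x : R) :
  measurable_fun setT f ->
  {ae mu, forall y, f y = c + (fine (m1 `]-oo, y]%classic) - fine (m2 `]-oo, y]%classic))} ->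
  0 < t ->
  heat_semigroup t f x =
    c + (\int[m1]_z heat_cdf t x z - \int[m2]_z heat_cdf t x z).
Proof.
move=> mf fE t0.
pose K y := heat_kernel t (x - y).
pose F m y := fine (m `]-oo, y]%classic : \bar R).
have mK : measurable_fun setT K by exact: measurable_heat_kernel.
have mF m : measurable_fun setT (F m) by exact: measurable_fine_distribution.
have mKF m : measurable_fun setT (fun y => K y * F m y).
  by apply: measurable_funM => //; exact: mF.
have iK : mu.-integrable setT (EFin \o K) by exact: integrable_heat_kernel.
have iKF m : mu.-integrable setT (EFin \o (fun y => K y * F m y)).
  rewrite (_ : _ \o _ = (EFin \o K) \* (EFin \o F m))%E; last exact/funext.
  apply: integrableMl => //; first exact: mF.
  exists (fine (m setT)); split; first exact: num_real.
  move=> M mM y _ /=; rewrite ger0_norm ?fine_ge0//.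
  apply: le_trans (ltW mM); rewrite fine_le ?fin_num_measure//.
  by apply: le_measure; rewrite ?inE.
have -> : heat_semigroup t f x =
    \int[mu]_y (c * K y + (K y * F m1 y - K y * F m2 y)).
  congr fine; apply: ae_eq_integral => //.
  - by apply/measurable_EFinP; exact: measurable_funM.
  - apply/measurable_EFinP; apply: measurable_funD; first exact: measurable_funM.
    by apply: measurable_funB; exact: mKF.
  - have [N [mN N0 sN]] := fE; exists N; split => // y ny; apply: sN => fy.
    by apply: ny => _; rewrite /= fy /K /F; congr (_%:E); ring.
rewrite RintegralD//.
- rewrite RintegralZl// RintegralB//.
  rewrite /K /F !heat_semigroup_distribution//.
  by rewrite /Rintegral integral_heat_kernel// mulr1.
- rewrite (_ : EFin \o _ = fun y => c%:E * (EFin \o K) y)%E; last exact/funext.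
  exact: integrableZl.
- rewrite (_ : _ \o _ = (EFin \o (fun y => K y * F m1 y)%R) \-
    (EFin \o (fun y => K y * F m2 y)%R))%E; last exact/funext.
  exact: integrableB.
Qed.

End heat_potential.

(** * Joint measurability and size of the derivatives on the half-plane *)

Section heat_gradient.
Context {R : realType}.
Variables m1 m2 : {finite_measure set (measurableTypeR R) -> \bar R}.
Implicit Types (m : {finite_measure set (measurableTypeR R) -> \bar R}).
Implicit Types (t x y z w : R).

Local Notation plane := (measurableTypeR R * measurableTypeR R)%type.

(* Equal to the heat kernel on t > 0 only; real powers replace the square root
   and the inverses so that joint measurability follows from measurable_powR. *)
Let K (p : plane * measurableTypeR R) : R :=
  (4 * pi * p.1.2) `^ (- 2^-1) *
  expR (- ((p.1.1 - p.2) ^+ 2) * (4 * p.1.2) `^ (-1)).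

Let KE x t z : 0 < t -> K ((x, t), z) = heat_kernel t (x - z).
Proof.
move=> t0; rewrite /K /heat_kernel /= powRN powR12_sqrt; last first.
  by rewrite !mulr_ge0 ?pi_ge0// ltW.
by rewrite powR_inv1// mulr_ge0// ltW.
Qed.

Let mx : measurable_fun setT (fun p : plane * measurableTypeR R => p.1.1 - p.2).
Proof.
apply: measurable_funB; last exact: measurable_snd.
exact: (measurableT_comp measurable_fst measurable_fst).
Qed.

Let mt : measurable_fun setT (fun p : plane * measurableTypeR R => p.1.2 : R).
Proof. exact: (measurableT_comp measurable_snd measurable_fst). Qed.

Let mtpow (c r : R) :
  measurable_fun setT (fun p : plane * measurableTypeR R => (c * p.1.2) `^ r).
Proof.
apply: (measurableT_comp (measurable_powR r)).
by apply: measurable_funM; [exact: measurable_cst|exact: mt].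
Qed.

Let mK : measurable_fun setT K.
Proof.
apply: measurable_funM; first exact: mtpow.
apply: measurableT_comp => //; apply: measurable_funM; last exact: mtpow.
by apply: measurableT_comp => //; apply: measurable_funX; exact: mx.
Qed.

Lemma measurable_heat_potential_plane m :
  measurable_fun (@upper_half_plane R : set plane)
    (fun p : plane => heat_potential m p.2 p.1).
Proof.
have := measurable_funTS (D := @upper_half_plane R : set plane)
  (measurable_Rintegral_param m mK).
apply: eq_measurable_fun => -[x t]; rewrite inE => t0.
by apply: eq_Rintegral => z _; exact: KE.
Qed.

Lemma measurable_heat_slope_plane m :
  measurable_fun (@upper_half_plane R : set plane)
    (fun p : plane => \int[m]_z (- ((p.1 - z) / (2 * p.2) * heat_kernel p.2 (p.1 - z)))).
Proof.
pose k p := - ((p.1.1 - p.2) * (2 * p.1.2) `^ (-1) * K p).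
have mk : measurable_fun setT k.
  apply: measurableT_comp => //; apply: measurable_funM => //.
  by apply: measurable_funM; [exact: mx|exact: mtpow].
have := measurable_funTS (D := @upper_half_plane R : set plane)
  (measurable_Rintegral_param m mk).
apply: eq_measurable_fun => -[x t]; rewrite inE /upper_half_plane /= => t0.
apply: eq_Rintegral => z _; rewrite /k /= KE// powR_inv1//.
by rewrite mulr_ge0// ltW.
Qed.

(** The pointwise bound on the slope kernel, integrated against m; the price is a factor t^(-1/2)
    and a potential at the doubled time. *)
Lemma normr_integral_slope_le m t x : 0 < t ->
  `|\int[m]_z (- ((x - z) / (2 * t) * heat_kernel t (x - z)))| <=
    2 * t `^ (- (1 / 2)) * heat_potential m (2 * t) x.
Proof.
move=> t0; have t20 : 0 < 2 * t by rewrite mulr_gt0.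
have ms : measurable_fun setT
    (fun z => - ((x - z) / (2 * t) * heat_kernel t (x - z))).
  apply: measurableT_comp => //; apply: measurable_funM.
    apply: measurable_funM => //; exact: measurable_funB.
  exact: measurable_heat_kernel.
have is_ : m.-integrable setT
    (EFin \o (fun z => - ((x - z) / (2 * t) * heat_kernel t (x - z)))).
  apply: (@bounded_integrable_finite _ _ _
    (2 * t `^ (- (1 / 2)) * (2 * t) `^ (- (1 / 2)))) => //.
  move=> z; rewrite normrN; apply: le_trans (heat_kernel_deriv_le _ t0) _.
  by rewrite ler_wpM2l ?mulr_ge0 ?powR_ge0// heat_kernel_le.
apply: le_trans (le_normr_Rintegral _ is_) _ => //.
rewrite /heat_potential -RintegralZl//; last exact: integrable_heat_kernel_finite.
apply: le_Rintegral => //.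
- exact: (integrable_abse is_).
- rewrite (_ : EFin \o _ = fun z => (2 * t `^ (- (1 / 2)))%:E *
    (EFin \o (fun z => heat_kernel (2 * t) (x - z))) z)%E; last exact/funext.
  by apply: integrableZl => //; exact: integrable_heat_kernel_finite.
- by move=> z _; rewrite normrN; exact: heat_kernel_deriv_le.
Qed.

End heat_gradient.

(** * Weak-type bounds for the derivatives of the heat extension *)

Theorem corollary1p12 (R : realType) (f : R -> R) (u : R * R -> R)
    (hf : homogeneous_BV f)
    (hu : forall x t : R, 0 < t -> u (x, t) = heat_semigroup t f x) :
  [/\ forall z : R * R, upper_half_plane z -> has_partials u z,
      weakLp (lebesgue_measure2 R) (@upper_half_plane R) (3 / 2) (partial_t u)
    & weakLp (lebesgue_measure2 R) (@upper_half_plane R) 3 (partial_x u)].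
Proof.
have [lf [nu fnu]] := hf.
(* The hypothesis on [nu] holds for every Hahn decomposition, so any one can be chosen. *)
have [P [N nuPN]] := Hahn_decomposition nu.
pose m1 : {finite_measure set (measurableTypeR R) -> \bar R} := jordan_pos nuPN.
pose m2 : {finite_measure set (measurableTypeR R) -> \bar R} := jordan_neg nuPN.
have [c fc] := @bv_ae_representation R f m1 m2 lf (fnu P N nuPN).
have mf : measurable_fun setT f by case: lf.
have uE x t : 0 < t -> u (x, t) =
    c + (\int[m1]_z heat_cdf t x z - \int[m2]_z heat_cdf t x z).
  by move=> t0; rewrite hu// (heat_semigroup_bv x mf fc t0).
have dx (x t : R) : 0 < t -> is_derive x 1 (fun y => u (y, t))
    (heat_potential m1 t x - heat_potential m2 t x).
  move=> t0; rewrite (_ : (fun _ => _) = fun y =>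
      c + (\int[m1]_z heat_cdf t y z - \int[m2]_z heat_cdf t y z)); last first.
    by apply/funext => y; exact: uE.
  have d1 := is_derive_integral_heat_cdf_x m1 x t0.
  have d2 := is_derive_integral_heat_cdf_x m2 x t0.
  by apply: is_derive_eq (is_deriveD (is_derive_cst c x 1) (is_deriveB d1 d2)) _; rewrite add0r.
pose S (m : {finite_measure set (measurableTypeR R) -> \bar R}) (t x : R) : R :=
    \int[m]_z (- ((x - z) / (2 * t) * heat_kernel t (x - z))).
have dt (x t : R) : 0 < t -> is_derive t 1 (fun s => u (x, s)) (S m1 t x - S m2 t x).
  (* The formula for u is known at positive times only, so the two functions of s are compared near
     t. *)
  move=> t0; apply: (@near_eq_is_derive R R R (fun s =>
      c + (\int[m1]_z heat_cdf s x z - \int[m2]_z heat_cdf s x z))).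
    by near=> s; rewrite uE//; near: s; exact: lt_nbhsr.
  have d1 := is_derive_integral_heat_cdf_t m1 x t0.
  have d2 := is_derive_integral_heat_cdf_t m2 x t0.
  by apply: is_derive_eq (is_deriveD (is_derive_cst c t 1) (is_deriveB d1 d2)) _; rewrite add0r.
have pxE (x t : R) : 0 < t -> partial_x u (x, t) = heat_potential m1 t x - heat_potential m2 t x.
  by move=> t0; rewrite /partial_x derive1E; have [] := dx x t t0.
have ptE (x t : R) : 0 < t -> partial_t u (x, t) = S m1 t x - S m2 t x.
  by move=> t0; rewrite /partial_t derive1E; have [] := dt x t t0.
split.
- by move=> [x t] t0; split; [have [] := dx x t t0|have [] := dt x t t0].
(* Time derivative: the slope bound has a = 1/2, with potentials at time 2t and constant 2. *)
- rewrite (_ : 3 / 2 = 3 / 2 / (1 / 2 + 1 / 2)); last by field.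
  apply: (@weak_type_heat_potential _ m1 m2 (1 / 2) 2 2) => //.
  + by rewrite ltr_pdivrMr// mul1r ltr1n.
  + by rewrite ler1n.
  + apply: (@eq_measurable_fun _ _ _ _ _ (fun p => S m1 p.2 p.1 - S m2 p.2 p.1)).
      by move=> [x t]; rewrite inE => t0; rewrite ptE.
    by apply: measurable_funB; exact: measurable_heat_slope_plane.
  + move=> x t t0; rewrite ptE// mulrDr; apply: le_trans (ler_normB _ _) _.
    by apply: lerD; exact: normr_integral_slope_le.
(* Space derivative: it is itself a difference of potentials at time t, so a = 0. *)
- rewrite (_ : 3 = 3 / 2 / (0 + 1 / 2)); last by field.
  apply: (@weak_type_heat_potential _ m1 m2 0 1 1) => //.
  + apply: (@eq_measurable_fun _ _ _ _ _
      (fun p => heat_potential m1 p.2 p.1 - heat_potential m2 p.2 p.1)).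
      by move=> [x t]; rewrite inE => t0; rewrite pxE.
    by apply: measurable_funB; exact: measurable_heat_potential_plane.
  + move=> x t t0; rewrite pxE// oppr0 powRr0 mulr1 !mul1r.
    apply: le_trans (ler_normB _ _) _.
    by rewrite !ger0_norm ?heat_potential_ge0.
Unshelve. all: by end_near. Qed.
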